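(* Let $\{{}^k\Upsilon\}_{k\ge0}$ be the truncation ideals of the operad $\mathcal{A}ss$ over the field $\Bbbk$. Let $\mathcal I$ be an operadic ideal of $\mathcal{A}ss$ and let $\mathcal P=\mathcal{A}ss/\mathcal I$ be the quotient operad. Let $k$ be a positive integer. Then $\operatorname{GKdim}\mathcal P\le k$ if and only if $\mathcal I\supseteq{}^k\Upsilon$. In particular, $$\operatorname{GKdim}(\mathcal{A}ss/{}^k\Upsilon)=\begin{cases}1,&k=1,2,\\ k,&k\ge3.\end{cases}$$
   Context: Fix a field $\Bbbk$; all operads are $\Bbbk$-linear symmetric operads (right $\mathbb S_n$-action $*$ on $\mathcal P(n)$, identity $\mathbf 1=\mathbf 1_1\in\mathcal P(1)$, compositions $\theta\circ(\theta_1,\dots,\theta_n)$ with the usual unit, associativity and equivariance axioms). $\mathcal{A}ss$ is the operad encoding unital associative $\Bbbk$-algebras: $\mathcal{A}ss(n)=\Bbbk\mathbb S_n$ (right regular module) for all $n\ge0$, with composition given by block permutations; $\mathbf 1_0$ is the identity of $\mathbb S_0$, a basis of $\mathcal{A}ss(0)=\Bbbk$. An operadic ideal $\mathcal I$ of $\mathcal P$ is a family of $\mathbb S_n$-submodules $\mathcal I(n)\subseteq\mathcal P(n)$ such that $\theta\circ(\theta_1,\dots,\theta_n)\in\mathcal I$ whenever at least one of $\theta,\theta_1,\dots,\theta_n$ is in $\mathcal I$; $(\mathcal P/\mathcal I)(n)=\mathcal P(n)/\mathcal I(n)$. Truncations: let $[n]=\{1,\dots,n\}$. For $I\subseteq[n]$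 with characteristic function $\chi_I$, $\pi^I(\theta)=\theta\circ(\mathbf 1_{\chi_I(1)},\dots,\mathbf 1_{\chi_I(n)})$. For $k\ge1$, ${}^k\Upsilon(n)=\bigcap_{I\subseteq[n],|I|=k-1}\ker(\pi^I:\mathcal{A}ss(n)\to\mathcal{A}ss(k-1))$ if $n\ge k$ and $0$ if $n<k$; ${}^0\Upsilon=\mathcal{A}ss$. Each ${}^k\Upsilon$ is an operadic ideal. $\operatorname{GKdim}\mathcal P=\limsup_{n\to\infty}\log_n\big(\sum_{i=0}^n\dim_\Bbbk\mathcal P(i)\big)$. *)

(* Defs.v *)
From HB Require Import structures.
From mathcomp Require Import all_boot all_order fingroup perm all_algebra.
From mathcomp Require Import generic_quotient ring_quotient.
From mathcomp Require Import all_classical all_reals all_analysis.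

Set Implicit Arguments.
Unset Strict Implicit.
Unset Printing Implicit Defensive.

Import Order.TTheory GRing.Theory Num.Theory.

Local Open Scope ring_scope.

(* The set of cosets of U, i.e. the quotient of V by x ~ y <-> x - y \in U. *)
Definition quotv (F : fieldType) (V : vectType F) (U : {vspace V}) : Type :=
  Quotient.quot (pred_of_vspace U).

Section QuotientSpace.
Import VectorInternalTheory.
Variables (F : fieldType) (V : vectType F) (U : {vspace V}).

HB.instance Definition _ :=
  GRing.Zmodule.copy (quotv U) (Quotient.quot (pred_of_vspace U)).

Definition quotv_pi (v : V) : quotv U :=
  (\pi_(Quotient.quot (pred_of_vspace U)) v)%qT.

Lemma quotv_pi_eq (v w : V) : (quotv_pi v == quotv_pi w) = (v - w \in U).
Proof. exact/esym/Quotient.idealrBE. Qed.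

Lemma quotv_piD : {morph quotv_pi : v w / v + w}.
Proof.
by move=> v w; exact: (raddfD (\pi_(Quotient.quot (pred_of_vspace U)))%qT).
Qed.

Definition quotv_repr (x : quotv U) : V :=
  generic_quotient.repr (x : Quotient.quot (pred_of_vspace U)).

Lemma quotv_reprK : cancel quotv_repr quotv_pi.
Proof. by move=> x; exact: reprK. Qed.

Definition quotv_scale (a : F) (x : quotv U) : quotv U :=
  quotv_pi (a *: quotv_repr x).

Lemma quotv_piZ a v : quotv_scale a (quotv_pi v) = quotv_pi (a *: v).
Proof.
apply/eqP; rewrite quotv_pi_eq -scalerBr memvZ// -quotv_pi_eq.
by rewrite quotv_reprK.
Qed.

Lemma quotv_scaleA a b x :
  quotv_scale a (quotv_scale b x) = quotv_scale (a * b) x.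
Proof. by rewrite -(quotv_reprK x) !quotv_piZ scalerA. Qed.

Lemma quotv_scale1 : left_id 1 quotv_scale.
Proof. by move=> x; rewrite -(quotv_reprK x) quotv_piZ scale1r. Qed.

Lemma quotv_scaleDr : right_distributive quotv_scale +%R.
Proof.
move=> a x y; rewrite -(quotv_reprK x) -(quotv_reprK y).
by rewrite -quotv_piD !quotv_piZ scalerDr quotv_piD.
Qed.

Lemma quotv_scaleDl x : {morph quotv_scale^~ x : a b / a + b}.
Proof.
by move=> a b; rewrite -(quotv_reprK x) !quotv_piZ scalerDl quotv_piD.
Qed.

HB.instance Definition _ := GRing.Zmodule_isLmodule.Build F (quotv U)
  quotv_scaleA quotv_scale1 quotv_scaleDr quotv_scaleDl.

Lemma quotv_pi_is_linear : linear quotv_pi.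
Proof. by move=> a v w; rewrite quotv_piD -quotv_piZ. Qed.

HB.instance Definition _ :=
  GRing.isLinear.Build F V (quotv U) _ quotv_pi quotv_pi_is_linear.

(* A complement of U provides coordinates on the quotient. *)
Lemma quotv_vect_axiom : Vector.axiom (\dim U^C) (quotv U).
Proof.
pose q := (\1 - projv U)%VF.
have qU v : q v \in (U^C)%VS.
  have -> : q v = daddv_pi U^C U v.
    have Uv : v \in (U + U^C)%VS by rewrite addv_complf memvf.
    rewrite add_lfunE opp_lfunE id_lfunE.
    by rewrite -{1}(daddv_pi_add (capv_compl U) Uv) addrAC subrr add0r.
  exact: memv_pi.
have q0 v : (q v == 0) = (v \in U).
  rewrite add_lfunE opp_lfunE id_lfunE subr_eq0.
  by apply/eqP/idP => [->|/projv_id//]; exact: memv_pi.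
pose p v : subvs_of U^C := vsproj U^C (q v).
have p_pi v : p (quotv_repr (quotv_pi v)) = p v.
  congr vsproj; apply/eqP; rewrite -subr_eq0 -linearB q0 -quotv_pi_eq.
  by rewrite quotv_reprK.
exists (fun x => v2r (p (quotv_repr x))).
  move=> a x y; rewrite -(quotv_reprK x) -(quotv_reprK y).
  by rewrite -linearP !p_pi /p !linearP.
exists (fun r => quotv_pi (vsval (r2v r : subvs_of U^C))) => [x|r].
  rewrite v2rK -{2}(quotv_reprK x) vsprojK//; apply/eqP.
  rewrite quotv_pi_eq -q0 linearB subr_eq0 /=.
  have qq v : q (q v) = q v.
    rewrite {1}/q add_lfunE opp_lfunE id_lfunE.
    rewrite [X in projv U X]add_lfunE opp_lfunE id_lfunE linearB /=.
    by rewrite projv_proj subrr subr0.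
  by rewrite qq.
rewrite p_pi /p -[RHS]r2vK; congr v2r; apply/val_inj; rewrite /= vsprojK//.
rewrite add_lfunE opp_lfunE id_lfunE; apply/eqP.
rewrite -subr_eq0 addrAC subrr add0r oppr_eq0.
set u := vsval _; have Uu : u \in (U^C)%VS by exact: subvsP.
have Uv : u \in (U + U^C)%VS by rewrite addv_complf memvf.
have cap0 : (U^C :&: U = 0)%VS by rewrite capvC capv_compl.
have := daddv_pi_add (capv_compl U) Uv.
by rewrite (daddv_pi_id cap0 Uu) => /(canRL (addrK _)) ->; rewrite subrr.
Qed.

HB.instance Definition _ :=
  Lmodule_hasFinDim.Build F (quotv U) quotv_vect_axiom.

Lemma dim_quotv : \dim {: quotv U} = (\dim {: V} - \dim U)%N.
Proof. by rewrite dimvf -dimv_compl. Qed.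

End QuotientSpace.

(* sigma : 'S_n stands for the word x_(sigma^-1 1) ... x_(sigma^-1 n), that is,
   sigma sends a letter to its position in the word. *)
Section BlockPerm.
Local Open Scope nat_scope.
Variables (n : nat) (k : 'I_n -> nat).
Variables (sigma : 'S_n) (sigmas : forall i, 'S_(k i)).

(* Letters and positions of the composite word range over 'I_(\sum_i k i); the
   a-th letter of the i-th block is tagnat.Rank i a. The block of sigma i-th
   position is preceded by all the blocks j with sigma j < sigma i. *)
Definition block_pos (l : 'I_(\sum_i k i)) : nat :=
  \sum_(j < n | sigma j < sigma (tagnat.sig1 l)) k j
    + sigmas (tagnat.sig1 l) (tagnat.sig2 l).

Lemma block_pos_lt_next i (a : 'I_(k i)) (A : pred 'I_n) :
  A i -> (forall j, sigma j < sigma i -> A j) ->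
  \sum_(j < n | sigma j < sigma i) k j + a < \sum_(j < n | A j) k j.
Proof.
move=> Ai Alt; rewrite [ltnRHS](bigID (fun j => sigma j < sigma i))/=.
rewrite (eq_bigl (fun j => A j && (sigma j < sigma i))); last first.
  by move=> j; case: ltnP => ji; rewrite ?andbF// andbT Alt.
by rewrite ltn_add2l (bigD1 i) ?Ai ?ltnn//= ltn_addr.
Qed.

Lemma block_pos_lt l : block_pos l < \sum_i k i.
Proof. exact: block_pos_lt_next. Qed.

Definition block_fun l : 'I_(\sum_i k i) := Ordinal (block_pos_lt l).

Lemma block_fun_inj : injective block_fun.
Proof.
move=> l m /(congr1 val) /=; rewrite /block_pos.
have lt_neq l1 l2 : sigma (tagnat.sig1 l1) < sigma (tagnat.sig1 l2) ->
    block_pos l1 < block_pos l2.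
  move=> h; apply: (@leq_trans (\sum_(j < n | sigma j < sigma (tagnat.sig1 l2)) k j)).
    by apply: block_pos_lt_next => // j /ltn_trans; apply.
  exact: leq_addr.
case: (ltngtP (sigma (tagnat.sig1 l)) (sigma (tagnat.sig1 m))) => [/lt_neq|/lt_neq|].
- by rewrite /block_pos => + e; rewrite e ltnn.
- by rewrite /block_pos => + e; rewrite e ltnn.
move=> /val_inj/perm_inj e h; rewrite -(tagnat.sig2K l) -(tagnat.sig2K m).
move: h; move: (tagnat.sig2 l) (tagnat.sig2 m); rewrite -e => a b.
by move=> /eqP; rewrite eqn_add2l => /eqP/val_inj/perm_inj ->.
Qed.

Definition block_perm : 'S_(\sum_i k i) := perm block_fun_inj.

End BlockPerm.

Section Ass.
Variable F : fieldType.

(* The space F[S_n], elements being written as their coefficient functions. *)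
Definition ass (n : nat) : Type := {ffun 'S_n -> F^o}.
HB.instance Definition _ n := Vector.copy (ass n) {ffun 'S_n -> F^o}.

Definition ass_basis n (sigma : 'S_n) : ass n :=
  [ffun tau => (tau == sigma)%:R].

Definition ass_one n : ass n := ass_basis 1%g.

(* theta * tau; products of permutations are composed left to right in the
   library, so the functional composite sigma \o tau is (tau * sigma)%g. *)
Definition ass_act n (theta : ass n) (tau : 'S_n) : ass n :=
  \sum_(sigma : 'S_n) theta sigma *: ass_basis (tau * sigma)%g.

Lemma ass_act_basis n (sigma tau : 'S_n) :
  ass_act (ass_basis sigma) tau = ass_basis (tau * sigma)%g.
Proof.
rewrite /ass_act (bigD1 sigma)//= ffunE eqxx scale1r big1 ?addr0// => s ns.
by rewrite ffunE (negbTE ns) scale0r.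
Qed.

Definition ass_comp n (k : 'I_n -> nat) (theta : ass n)
    (thetas : forall i, ass (k i)) : ass (\sum_i k i) :=
  \sum_(sigma : 'S_n) \sum_(sigmas : {dffun forall i : 'I_n, 'S_(k i)})
    (theta sigma * \prod_i thetas i (sigmas i))
      *: ass_basis (block_perm sigma sigmas).

Lemma ass_comp_basis n (k : 'I_n -> nat) (sigma : 'S_n)
    (sigmas : forall i, 'S_(k i)) :
  ass_comp (ass_basis sigma) (fun i => ass_basis (sigmas i)) =
  ass_basis (block_perm sigma sigmas).
Proof.
pose ss0 : {dffun forall i : 'I_n, 'S_(k i)} := [ffun i => sigmas i].
have bE : block_perm sigma ss0 = block_perm sigma sigmas.
  by apply/permP => l; apply/val_inj; rewrite !permE /= /block_pos ffunE.
rewrite /ass_comp (bigD1 sigma)//= [X in _ + X]big1 ?addr0; last first.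
  move=> s ns; apply: big1 => ss _.
  by rewrite ffunE (negbTE ns) mul0r scale0r.
rewrite (bigD1 ss0)//= [X in _ + X]big1 ?addr0; last first.
  move=> ss nss; suff /existsP[i nsi] : [exists i, ss i != sigmas i].
    rewrite [\prod_(j < n) _](bigD1 i)//= !ffunE (negbTE nsi).
    by rewrite mul0r mulr0 scale0r.
  rewrite -negb_forall; apply: contra nss => /forallP e.
  by apply/eqP/ffunP => i; rewrite ffunE; exact/eqP/e.
rewrite ffunE eqxx mul1r bE [\prod_(i < n) _]big1 ?scale1r// => i _.
by rewrite !ffunE eqxx.
Qed.

Lemma ass_comp_linear n (k : 'I_n -> nat) (thetas : forall i, ass (k i)) :
  linear (fun theta : ass n => ass_comp theta thetas).
Proof.
move=> a x y; rewrite /ass_comp scaler_sumr -big_split; apply: eq_bigr => s _ /=.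
rewrite scaler_sumr -big_split; apply: eq_bigr => ss _ /=.
by rewrite !ffunE scalerA mulrA -scalerDl -mulrDl.
Qed.

Record operadic_ideal (I : forall n, {vspace ass n}) : Prop := OperadicIdeal {
  operadic_ideal_act : forall n (theta : ass n) (tau : 'S_n),
    theta \in I n -> ass_act theta tau \in I n;
  operadic_ideal_comp : forall n (k : 'I_n -> nat) (theta : ass n)
      (thetas : forall i, ass (k i)),
    theta \in I n \/ (exists i, thetas i \in I (k i)) ->
    ass_comp theta thetas \in I (\sum_i k i)%N
}.

(* The truncation pi^A; its codomain is Ass(#|A|), up to the equality
   \sum_(i < n) (i \in A) = #|A|. *)
Definition trunc_fun n (A : {set 'I_n}) (theta : ass n) :
    ass (\sum_(i < n) (i \in A)) :=
  ass_comp theta (fun i => ass_one (i \in A)).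

HB.instance Definition _ n (A : {set 'I_n}) :=
  GRing.isLinear.Build F (ass n) (ass (\sum_(i < n) (i \in A))) _
    (trunc_fun A) (@ass_comp_linear n (fun i => i \in A) _).

Definition trunc n (A : {set 'I_n}) : 'Hom(ass n, ass (\sum_(i < n) (i \in A))) :=
  linfun (trunc_fun A).

Definition Upsilon (k n : nat) : {vspace ass n} :=
  if k is k'.+1 then
    if (k <= n)%N then (\bigcap_(A : {set 'I_n} | #|A| == k') lker (trunc A))%VS
    else 0%VS
  else fullv.

Definition ass_quot (I : forall n, {vspace ass n}) (n : nat) : vectType F :=
  quotv (I n).

End Ass.

(* limsup of log_n (\sum_(i <= n) dim P(i)), with values in the extended reals;
   log 0 = -oo, and the terms n = 0, 1 are irrelevant. *)
Definition GKdim (R : realType) (F : fieldType) (P : nat -> vectType F) :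
    \bar R :=
  limn_esup (fun n =>
    lne ((\sum_(i < n.+1) \dim {: P i})%N%:R%:E) * ((ln (n%:R : R))^-1)%:E)%E.

(* Main.v *)
Require Import Defs.
From HB Require Import structures.
From mathcomp Require Import all_boot all_order fingroup perm all_algebra.
From mathcomp Require Import zify.
From mathcomp Require Import all_classical all_reals all_analysis.

Set Implicit Arguments.
Unset Strict Implicit.
Unset Printing Implicit Defensive.

Import Order.TTheory GRing.Theory Num.Theory.
Import numFieldNormedType.Exports.

(** Deleting letters from words is the only operation that matters here. For an
    injection f : 'I_m -> 'I_n let [restr f] send a word in n letters to the
    word formed by the letters in the image of f, renamed by f. The truncations
    are the maps [restr f] for increasing f ([trunc_restr]), the right action
    is [restr] of a permutation, and an operadic ideal I is stable under every
    [restr f] and under [pad g], which appends new letters at the end of a word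
    and renames all of them ([ideal_restr], [ideal_pad]).

    If Upsilon^k is not contained in I, restrict an element of the difference
    to as few letters as possible while staying outside I. The result theta has
    m >= k letters, because elements of Upsilon^k vanish on fewer than k letters
    ([Upsilon_restr0]), and all its proper restrictions lie in I. For every
    m-element set A of n letters, let theta_A be theta written on the letters
    of A, followed by the remaining letters. Restricting theta_A to A gives
    back theta, while restricting it to another m-element set B first deletes a
    letter of theta, hence gives an element of I. So the theta_A are linearly
    independent modulo I(n), the quotient has dimension at least 'C(n, m) in
    arity n ([dim_lower]), and its GK-dimension is at least m + 1 > k.

    Conversely Upsilon^k(n) is the common kernel of 'C(n, k - 1) maps to spaces
    of dimension (k - 1)!, so its codimension is at most n ^_ (k - 1)
    ([codim_Upsilon]); summing over arities up to n gives a bound of order n^k.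

    For the value at I = Upsilon^k the lower bound argument applies with m < k
    to any nonzero theta in Ass(m) all of whose proper restrictions vanish
    ([GKdim_Upsilon_ge]). With m = k - 1 this is a nonzero element of
    Upsilon^m(m), which exists for m >= 2 by a dimension count
    ([Upsilon_top_neq0]). There is none for m = 1, and correspondingly
    Upsilon^1 is contained in Upsilon^2 ([Upsilon1_sub2]): the upper bound 1
    for k = 1 also holds for k = 2, and m = 0 gives the lower bound 1. *)

Local Open Scope ring_scope.
Local Open Scope ereal_scope.

(** * Standardization *)

Section Standardization.
Local Open Scope nat_scope.
Variable m : nat.
Implicit Types (g : 'I_m -> nat) (s t : 'S_m).

(** A permutation is recovered from the order of its values. *)
Lemma card_perm_lt s i : #|[set j | s j < s i]| = s i.
Proof.
have -> : [set j | s j < s i] = s @^-1: [set x : 'I_m | x < s i].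
  by apply/setP => j; rewrite !inE.
rewrite card_preimset; last exact: perm_inj.
rewrite -sum1dep_card -(@big_ord_widen _ _ _ (s i) m (fun=> 1)) ?sum1_card ?card_ord//.
exact/ltnW.
Qed.

Lemma perm_order_inj s t :
  (forall i j, (s i < s j) = (t i < t j)) -> s = t.
Proof.
move=> st; apply/permP => i; apply/val_inj => /=.
rewrite -card_perm_lt -[RHS]card_perm_lt; apply: eq_card => j.
by rewrite !inE st.
Qed.

(** [std g] orders the letters as their keys g do. It is characterized by its
    order pattern ([stdE], [std_eq]), so identities between standardizations are
    checked by comparing patterns, not values. *)
Definition std g : 'S_m :=
  odflt 1%g [pick s : 'S_m | [forall i, forall j, (s i < s j) == (g i < g j)]].

Lemma stdE g : injective g -> forall i j, (std g i < std g j) = (g i < g j).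
Proof.
move=> g_inj; rewrite /std; case: pickP => [s /forallP gs i j|].
  by have /forallP/(_ j)/eqP := gs i.
(* The rank of a letter counts the letters with a smaller key. *)
pose rk i := #|[set j | g j < g i]|.
have rk_lt i : rk i < m.
  rewrite -[X in _ < X]card_ord -cardsT; apply: proper_card; apply/properP.
  by split; [exact: finset.subsetT|exists i; rewrite !inE ?ltnn].
have rk_mono i j : g i < g j -> rk i < rk j.
  move=> gij; apply: proper_card; apply/properP; split.
    by apply/fintype.subsetP => l; rewrite !inE => /ltn_trans; apply.
  by exists i; rewrite inE ?ltnn.
have rk_lt_eq i j : (rk i < rk j) = (g i < g j).
  apply/idP/idP; last exact: rk_mono.
  apply: contraTT; rewrite -!leqNgt leq_eqVlt => /orP[/eqP/g_inj -> //|].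
  by move=> /rk_mono/ltnW.
pose r i := Ordinal (rk_lt i).
have r_inj : injective r.
  move=> i j /(congr1 val) /= rij; apply: g_inj; move: (rk_lt_eq i j) (rk_lt_eq j i).
  by rewrite rij ltnn; case: ltngtP.
move=> /(_ (perm r_inj)) /forallP[] i; apply/forallP => j.
by rewrite !permE /= rk_lt_eq.
Qed.

Lemma std_eq g s : (forall i j, (s i < s j) = (g i < g j)) -> std g = s.
Proof.
move=> gs; apply: perm_order_inj => i j; rewrite gs stdE// => x y gxy.
apply: (@perm_inj _ s); apply/val_inj; move: (gs x y) (gs y x).
by rewrite gxy ltnn /=; case: ltngtP.
Qed.

End Standardization.

Lemma std_comp m n (g : 'I_n -> nat) (f : 'I_m -> 'I_n) :
  injective g -> injective f -> std (std g \o f) = std (g \o f).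
Proof.
move=> gi fi; apply: std_eq => i j.
by rewrite stdE /= ?stdE//; apply: inj_comp.
Qed.


(** * Linear maps induced by maps of permutations *)

Section BasisMaps.
Local Open Scope ring_scope.
Variable F : fieldType.

Definition ass_map_fun n m (phi : 'S_n -> 'S_m) (theta : ass F n) : ass F m :=
  \sum_s theta s *: ass_basis F (phi s).

Lemma ass_map_is_linear n m (phi : 'S_n -> 'S_m) : linear (ass_map_fun phi).
Proof.
move=> a x y; rewrite /ass_map_fun scaler_sumr -big_split; apply: eq_bigr => s _ /=.
by rewrite !ffunE scalerA -scalerDl.
Qed.

HB.instance Definition _ n m (phi : 'S_n -> 'S_m) :=
  GRing.isLinear.Build F (ass F n) (ass F m) _ (ass_map_fun phi)
    (ass_map_is_linear phi).

Definition ass_map n m (phi : 'S_n -> 'S_m) : 'Hom(ass F n, ass F m) :=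
  linfun (ass_map_fun phi).

Lemma ass_mapE n m (phi : 'S_n -> 'S_m) theta :
  ass_map phi theta = \sum_s theta s *: ass_basis F (phi s).
Proof. by rewrite lfunE. Qed.

Lemma ass_sum_basis n (theta : ass F n) :
  theta = \sum_s theta s *: ass_basis F s.
Proof.
apply/ffunP => t; rewrite sum_ffunE (bigD1 t)//= !ffunE eqxx.
rewrite big1 ?addr0 => [|s st]; first by rewrite -[LHS]mulr1.
by rewrite !ffunE eq_sym (negbTE st) -[LHS]/(_ * _) mulr0.
Qed.

Lemma ass_map_basis n m (phi : 'S_n -> 'S_m) s :
  ass_map phi (ass_basis F s) = ass_basis F (phi s).
Proof.
rewrite ass_mapE (bigD1 s)//= ffunE eqxx scale1r big1 ?addr0// => t ts.
by rewrite ffunE (negbTE ts) scale0r.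
Qed.

Lemma ass_map_uniq n m (phi : 'S_n -> 'S_m) (f : ass F n -> ass F m) :
  linear f -> (forall s, f (ass_basis F s) = ass_basis F (phi s)) ->
  f =1 ass_map phi.
Proof.
move=> f_lin fb theta.
pose fL := GRing.isLinear.Build F (ass F n) (ass F m) _ f f_lin.
pose f' : {linear ass F n -> ass F m} := HB.pack f fL.
rewrite ass_mapE {1}(ass_sum_basis theta) -[f _]/(f' _) linear_sum.
by apply: eq_bigr => s _; rewrite linearZ /= fb.
Qed.

Lemma ass_map_comp n m p (phi : 'S_n -> 'S_m) (psi : 'S_m -> 'S_p) theta :
  ass_map psi (ass_map phi theta) = ass_map (psi \o phi) theta.
Proof.
rewrite [in LHS](ass_mapE phi) linear_sum [RHS]ass_mapE; apply: eq_bigr => s _.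
by rewrite linearZ /= ass_map_basis.
Qed.

Lemma eq_ass_map n m (phi psi : 'S_n -> 'S_m) theta :
  phi =1 psi -> ass_map phi theta = ass_map psi theta.
Proof. by move=> /funext ->. Qed.

Lemma ass_map_id n theta : @ass_map n n id theta = theta.
Proof. by rewrite ass_mapE -ass_sum_basis. Qed.

Lemma dim_ass n : \dim {: ass F n} = n`!.
Proof.
by rewrite dimvf /dim /= muln1 card_Sn.
Qed.

End BasisMaps.

(** * Restriction and padding of words *)

Section Restriction.
Local Open Scope ring_scope.
Variable F : fieldType.

Definition restr m n (f : 'I_m -> 'I_n) : 'Hom(ass F n, ass F m) :=
  ass_map F (fun s => std (fun i => s (f i) : nat)).

(** Position of a letter in the word s followed by p new letters in order. *)
Definition letter_pos m p (s : 'S_m) (u : 'I_m + 'I_p) : nat :=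
  match u with inl i => s i | inr j => (m + j)%N end.

Definition pad n m p (g : 'I_n -> 'I_m + 'I_p) : 'Hom(ass F m, ass F n) :=
  ass_map F (fun s => std (letter_pos s \o g)).

Lemma letter_pos_inj m p (s : 'S_m) : injective (@letter_pos m p s).
Proof.
move=> [i|i] [j|j] /=.
- by move=> /val_inj/perm_inj ->.
- by move=> e; have := ltn_ord (s i); rewrite e ltnNge leq_addr.
- by move=> e; have := ltn_ord (s j); rewrite -e ltnNge leq_addr.
- by move=> /eqP; rewrite eqn_add2l => /eqP/val_inj ->.
Qed.

Lemma perm_nat_inj m (s : 'S_m) : injective (fun i => s i : nat).
Proof. by move=> i j /val_inj/perm_inj. Qed.

Lemma restr_comp l m n (f : 'I_l -> 'I_m) (g : 'I_m -> 'I_n) theta :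
  injective f -> injective g -> restr f (restr g theta) = restr (g \o f) theta.
Proof.
move=> fi gi; rewrite /restr ass_map_comp.
apply: eq_ass_map => s /=.
exact: (std_comp (inj_comp (@perm_nat_inj _ s) gi) fi).
Qed.

Lemma restr_pad l n m p (f : 'I_l -> 'I_n) (g : 'I_n -> 'I_m + 'I_p) theta :
  injective f -> injective g -> restr f (pad g theta) = pad (g \o f) theta.
Proof.
move=> fi gi; rewrite /restr ass_map_comp.
apply: eq_ass_map => s /=.
exact: (std_comp (inj_comp (@letter_pos_inj _ _ s) gi) fi).
Qed.

(** Padding ignores the letters that are deleted beforehand: when h misses
    them, padding along h factors through the restriction along r. *)
Lemma pad_restr n m c p (r : 'I_c -> 'I_m) (g : 'I_n -> 'I_c + 'I_p)
    (h : 'I_n -> 'I_m + 'I_p) theta :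
  injective r -> injective g -> injective h ->
  (forall x, h x = match g x with inl i => inl (r i) | inr j => inr j end) ->
  pad g (restr r theta) = pad h theta.
Proof.
move=> ri gi hi hE; rewrite /restr ass_map_comp.
apply: eq_ass_map => s /=; apply: std_eq => x y.
rewrite [LHS]stdE /=; last exact: inj_comp (@letter_pos_inj _ _ _) hi.
have si : injective (fun i => s (r i) : nat) by move=> i j /val_inj/perm_inj/ri.
rewrite !hE; case: (g x) => i; case: (g y) => j /=; rewrite ?ltn_add2l ?stdE//.
- by rewrite !ltn_addr.
- by rewrite !ltnNge !(leq_trans (ltnW (ltn_ord _)) (leq_addr _ _)).
Qed.

Lemma pad_inl m p (g : 'I_m -> 'I_m + 'I_p) theta :
  (forall i, g i = inl i) -> pad g theta = theta.
Proof.
move=> gE; rewrite -[RHS]ass_map_id.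
by apply: eq_ass_map => s; apply: std_eq => i j /=; rewrite !gE.
Qed.

Lemma restr_id m (f : 'I_m -> 'I_m) theta :
  (forall i, f i = i) -> restr f theta = theta.
Proof.
move=> fE; rewrite -[RHS]ass_map_id.
by apply: eq_ass_map => s; apply: std_eq => i j /=; rewrite !fE.
Qed.

Lemma ass_act_restr m (tau : 'S_m) (theta : ass F m) :
  ass_act theta tau = restr tau theta.
Proof.
rewrite /restr ass_mapE; apply: eq_bigr => s _; congr (_ *: ass_basis _ _).
by apply/esym/std_eq => i j; rewrite !permM.
Qed.

(** The block and the index of the letter [Rank i a] are equal to i and a only
    up to a transport, whence the passage through the sigma type. *)
Lemma block_pos_Rank n (k : 'I_n -> nat) (s : 'S_n) (ss : forall i, 'S_(k i))
    i (a : 'I_(k i)) :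
  block_pos s ss (tagnat.Rank i a) = (\sum_(j < n | (s j < s i)%N) k j + ss i a)%N.
Proof.
pose G (q : {i & 'I_(k i)}) :=
  (\sum_(j < n | (s j < s (tag q))%N) k j + ss (tag q) (tagged q))%N.
rewrite -[RHS]/(G (Tagged (fun i => 'I_(k i)) a)) -[LHS]/(G (Tagged (fun i => 'I_(k i)) _)).
by rewrite -tagnat.sigE12 tagnat.rankK.
Qed.

Lemma block_perm_lt n (k : 'I_n -> nat) (s : 'S_n) (ss : forall i, 'S_(k i)) l l' :
  (s (tagnat.sig1 l) < s (tagnat.sig1 l'))%N ->
  (block_perm s ss l < block_perm s ss l')%N.
Proof.
move=> ll'; rewrite !permE /=.
have /leq_trans -> // : (block_pos s ss l <
  \sum_(j < n | (s j < s (tagnat.sig1 l'))%N) k j)%N.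
  by apply: block_pos_lt_next => // j /ltn_trans; apply.
exact: leq_addr.
Qed.

Lemma sig1_bool_inj n (A : {set 'I_n}) :
  injective (@tagnat.sig1 n (fun i => (i \in A) : nat)).
Proof.
move=> l l' e; rewrite -(tagnat.sig2K l) -(tagnat.sig2K l').
move: (tagnat.sig2 l) (tagnat.sig2 l'); rewrite -e => a b; congr (tagnat.Rank _ _).
apply/val_inj => /=; have := leq_trans (ltn_ord a) (leq_b1 _).
by have := leq_trans (ltn_ord b) (leq_b1 _); rewrite !ltnS !leqn0 => /eqP -> /eqP ->.
Qed.

(** Substituting 1_0 for a letter deletes it and substituting 1_1 keeps it, so a
    truncation is a restriction along the increasing enumeration of A, which is
    the map from a letter of the composite word to its block. *)
Lemma trunc_restr n (A : {set 'I_n}) theta :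
  trunc F A theta = restr (@tagnat.sig1 n (fun i => i \in A)) theta.
Proof.
rewrite /trunc lfunE /=; apply: ass_map_uniq; first exact: ass_comp_linear.
move=> s; rewrite /trunc_fun ass_comp_basis; congr ass_basis.
apply/esym/std_eq => l l'.
have lt_mono := @block_perm_lt _ (fun i => (i \in A) : nat) s (fun=> 1%g).
have [/lt_mono -> //|/lt_mono|] := ltngtP (s (tagnat.sig1 l)) (s (tagnat.sig1 l')).
  by move=> /ltnW; rewrite leqNgt => /negbTE.
by move=> /val_inj/perm_inj/sig1_bool_inj ->; rewrite ltnn.
Qed.

End Restriction.

(** * Operadic ideals are stable under restriction and padding *)

Section Ideals.
Local Open Scope ring_scope.
Variable F : fieldType.

(** The injection f factors through the enumeration of A by an injection, which
    need not be increasing. *)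
Lemma restr_factor_trunc n (A : {set 'I_n}) m (f : 'I_m -> 'I_n) :
  injective f -> (forall i, f i \in A) ->
  exists2 r : 'I_m -> 'I_(\sum_(i < n) (i \in A)), injective r &
    forall theta : ass F n, restr F f theta = restr F r (trunc F A theta).
Proof.
move=> fi fA.
have fA0 i : (0 < (f i \in A))%N by rewrite fA.
pose r i := tagnat.Rank (p_ := fun i => i \in A) (f i) (Ordinal (fA0 i)).
have rE i : tagnat.sig1 (r i) = f i by exact: tagnat.Rank1K.
have ri : injective r by move=> i j e; apply: fi; rewrite -!rE e.
exists r; first exact: ri.
move=> theta; rewrite trunc_restr restr_comp; [|exact: ri|exact: sig1_bool_inj].
by apply: eq_ass_map => s; congr std; apply/funext => i /=; rewrite rE.
Qed.

(** Truncate to the image of f, then permute: both operations preserve I. *)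
Lemma ideal_restr (I : forall n, {vspace ass F n}) m n (f : 'I_m -> 'I_n) theta :
  operadic_ideal I -> injective f -> theta \in I n -> restr F f theta \in I m.
Proof.
move=> idI fi theta_I; pose A := f @: [set: 'I_m].
have [|r ri ->] := @restr_factor_trunc _ A _ f fi.
  by move=> i; apply: imset_f.
have cA : (\sum_(i < n) (i \in A) = m)%N.
  by rewrite -big_mkcond/= sum1_card card_imset// cardsT card_ord.
have tr_I : trunc F A theta \in I (\sum_(i < n) (i \in A))%N.
  by rewrite /trunc lfunE; apply: (operadic_ideal_comp idI); left.
move: r ri (trunc F A theta) tr_I; rewrite cA => r ri th th_I.
have -> : restr F r th = ass_act th (perm ri).
  rewrite ass_act_restr; apply: eq_ass_map => s.
  by congr std; apply/funext => i; rewrite permE.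
exact: (operadic_ideal_act idI).
Qed.

(** A family over 'I_2 given by its two members; the match is kept visible so
    that the arities reduce to m and p. *)
Definition two_blocks m p (i : 'I_2) : nat := if val i is 0 then m else p.

Definition two_family (X : nat -> Type) m p (x : X m) (y : X p) (i : 'I_2) :
    X (two_blocks m p i) :=
  match val i as v return X (if v is 0 then m else p) with 0 => x | _.+1 => y end.

(** The composite 1_2 o (theta, 1_p), which appends p new letters to theta. *)
Definition juxt m p (theta : ass F m) : ass F (\sum_i two_blocks m p i) :=
  ass_comp (ass_one F 2) (two_family (X := ass F) theta (ass_one F p)).

Lemma juxt_is_linear m p : linear (@juxt m p).
Proof.
move=> a x y; rewrite /juxt /ass_comp scaler_sumr -big_split; apply: eq_bigr => s _ /=.
rewrite scaler_sumr -big_split; apply: eq_bigr => ss _ /=.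
rewrite scalerA -scalerDl; congr (_ *: _).
rewrite !big_ord_recl /= !ffunE /= -[_ *: _]/(_ * _) !mulrDl mulrDr; congr (_ + _).
by rewrite -!mulrA mulrCA.
Qed.

Lemma juxt_map m p theta : @juxt m p theta =
  ass_map F (fun s => block_perm 1%g
    (two_family (X := fun n => 'S_n) s (1%g : 'S_p))) theta.
Proof.
apply: ass_map_uniq; first exact: juxt_is_linear.
move=> s; rewrite /juxt -ass_comp_basis; congr ass_comp.
by apply: functional_extensionality_dep => -[[|[]] ?].
Qed.

Definition two_pos m p (u : 'I_m + 'I_p) : 'I_(\sum_i two_blocks m p i) :=
  match u with
  | inl i => tagnat.Rank (p_ := two_blocks m p) ord0 i
  | inr j => tagnat.Rank (p_ := two_blocks m p) (lift ord0 ord0) j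
  end.

Lemma two_pos_letter_pos m p (s : 'S_m) (u : 'I_m + 'I_p) :
  block_perm 1%g (two_family (X := fun n => 'S_n) s (1%g : 'S_p)) (two_pos u)
    = letter_pos s u :> nat.
Proof.
rewrite permE /=; case: u => i /=; rewrite block_pos_Rank /two_family /= ?perm1.
  by rewrite big_pred0// => j; rewrite !perm1.
by rewrite big_mkcond !big_ord_recl big_ord0 /= !perm1 /two_blocks /= !addn0.
Qed.

(** Padding along g is juxtaposition with 1_p followed by a restriction: g
    chooses which letters of the longer word are kept, and their names. *)
Lemma ideal_pad (I : forall n, {vspace ass F n}) m n p
    (g : 'I_n -> 'I_m + 'I_p) theta :
  operadic_ideal I -> injective g -> theta \in I m -> pad F g theta \in I n.
Proof.
move=> idI gi theta_I.
have pos_inj : injective (@two_pos m p \o g).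
  apply: inj_comp gi => u v uv; apply: (@letter_pos_inj _ _ 1%g).
  by rewrite -!two_pos_letter_pos; congr (block_perm _ _ _ : nat).
have -> : pad F g theta = restr F (@two_pos m p \o g) (juxt p theta).
  rewrite juxt_map /restr ass_map_comp; apply: eq_ass_map => s /=.
  by congr std; apply/funext => i /=; rewrite two_pos_letter_pos.
apply: ideal_restr => //; apply: (operadic_ideal_comp idI); right.
by exists ord0.
Qed.

End Ideals.

(** * Binomial lower bound for dimensions *)

Section Counting.
Local Open Scope ring_scope.
Variable F : fieldType.

(** The subspace K i contains W and every v j but v i, so v i is not in the span
    of W and the other v j. *)
Lemma dim_separated (V : vectType F) (T : finType) (v : T -> V)
    (K : T -> {vspace V}) (W : {vspace V}) :
  (forall i, W <= K i)%VS -> (forall i j, i != j -> v j \in K i) ->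
  (forall i, v i \notin K i) -> (\dim W + #|T| <= \dim {: V})%N.
Proof.
move=> WK vK vnK; rewrite cardE; have := enum_uniq T.
suff H s : uniq s -> (\dim W + size s <= \dim (W + <<map v s>>))%N.
  by move=> /H/leq_trans; apply; exact/dimvS/subvf.
elim: s => [_|i s IH /= /andP[nis /IH{}IH]]; first by rewrite addn0 dimvS// addvSl.
rewrite addnS span_cons; apply: leq_ltn_trans IH _.
have sub : (W + <<map v s>> <= W + (<[v i]> + <<map v s>>))%VS.
  by apply: addvS => //; exact: addvSr.
have := dimvS sub; rewrite leq_eqVlt => /orP[|//].
rewrite (dimv_leqif_eq sub) => /eqP e; case/negP: (vnK i).
have : v i \in (W + (<[v i]> + <<map v s>>))%VS.
  by rewrite (subvP (addvSr _ _))// (subvP (addvSl _ _))// memv_line.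
rewrite -e; apply/subvP; rewrite subv_add WK; apply/span_subvP => _ /mapP[j js ->].
by apply: vK; apply: contraNneq nis => ->.
Qed.

Variables (J : forall c, {vspace ass F c}) (m : nat) (theta : ass F m).
Hypothesis J_pad : forall c p (g : 'I_m -> 'I_c + 'I_p) y,
  injective g -> y \in J c -> pad F g y \in J m.
Hypothesis theta_restr : forall c (r : 'I_c -> 'I_m),
  injective r -> (c < m)%N -> restr F r theta \in J c.

(** If h misses the letter i0, then padding theta along h first restricts theta
    to a proper subset of its letters, and this restriction lies in J. *)
Lemma pad_missing_letter p (h : 'I_m -> 'I_m + 'I_p) i0 :
  injective h -> (forall x, h x <> inl i0) -> pad F h theta \in J m.
Proof.
move=> hi hi0; pose R := [set i | [exists x, h x == inl i]].
have R_lt : (#|R| < m)%N.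
  rewrite -[X in (_ < X)%N](card_ord m) -cardsT; apply: proper_card; apply/properP.
  split; first exact: finset.subsetT.
  exists i0; rewrite inE//; apply/existsP => -[x /eqP]; exact: hi0.
pose r : 'I_#|R| -> 'I_m := enum_val.
have [|g gE] := @boolp.choice _ _ (fun x u => h x =
    match u with inl j => inl (r j) | inr j => inr j end).
  move=> x; case hx: (h x) => [i|j]; last by exists (inr j).
  have iR : i \in R by rewrite inE; apply/existsP; exists x; rewrite hx.
  by exists (inl (enum_rank_in iR i)); rewrite /r enum_rankK_in.
have gi : injective g by move=> x y e; apply: hi; rewrite !gE e.
rewrite -(pad_restr _ (@enum_val_inj _ R) gi hi gE).
by apply: J_pad => //; apply: theta_restr => //; exact: enum_val_inj.
Qed.

(** The vectors theta_A, for A an m-element set of letters, are separated by the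
    preimages of J m under the restrictions to these sets. The family J is an
    operadic ideal in one application and zero in the other, and W is the part
    of arity n of the ideal by which Ass is divided. *)
Lemma dim_lower n (W : {vspace ass F n}) : theta \notin J m ->
  (forall f : 'I_m -> 'I_n, injective f ->
    forall w, w \in W -> restr F f w \in J m) ->
  (\dim W + 'C(n, m) <= n`!)%N.
Proof.
move=> theta_nJ W_restr.
pose T := {A : {set 'I_n} | #|A| == m}.
have -> : 'C(n, m) = #|{: T}|.
  by rewrite card_sig -{1}(card_ord n) -card_draws; apply: eq_card => A; rewrite !inE.
(* f A enumerates A; g A sends a letter of A to its index and any other letter
   to itself as a new letter, so that padding along g A gives theta_A. *)
pose f (A : T) (i : 'I_m) : 'I_n := enum_val (cast_ord (esym (eqP (valP A))) i).
have fi A : injective (f A) by move=> i j /enum_val_inj/cast_ord_inj.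
have fA A i : f A i \in val A by exact: enum_valP.
have fonto (A : T) x : x \in val A -> exists i, f A i = x.
  move=> xA; exists (cast_ord (eqP (valP A)) (enum_rank_in xA x)).
  by rewrite /f cast_ordK enum_rankK_in.
pose g (A : T) (x : 'I_n) : 'I_m + 'I_n :=
  if [pick i | f A i == x] is Some i then inl i else inr x.
have gl (A : T) x i : g A x = inl i -> f A i = x.
  by rewrite /g; case: pickP => // j /eqP fj [<-].
have gr (A : T) x y : g A x = inr y -> x = y by rewrite /g; case: pickP => // _ [].
have gi A : injective (g A).
  move=> x y; case gx: (g A x) => [i|j]; last by move=> /esym/gr ->; exact: gr gx.
  by move=> /esym/gl <-; rewrite (gl _ _ _ gx).
have gf A i : g A (f A i) = inl i.
  by rewrite /g; case: pickP => [j /eqP/fi -> //|/(_ i)/eqP].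
rewrite -(dim_ass F); apply: (@dim_separated _ _ (fun A => pad F (g A) theta)
  (fun A => restr F (f A) @^-1: J m)%VS).
- by move=> A; apply/subvP => w wW; rewrite -memv_preim W_restr.
- move=> B A BA; rewrite -memv_preim restr_pad//.
  have [a aA aB] : exists2 a, a \in val A & a \notin val B.
    apply/subsetPn; apply: contra BA => AB; rewrite -val_eqE eq_sym eqEcard AB.
    by rewrite (eqP (valP A)) (eqP (valP B)) leqnn.
  have [i0 fi0] := fonto _ _ aA.
  apply: (@pad_missing_letter _ _ i0); first exact: inj_comp.
  by move=> x /= /gl; rewrite fi0 => ax; move: (fA B x); rewrite -ax (negbTE aB).
- move=> A; rewrite -memv_preim restr_pad// pad_inl//; exact: gf.
Qed.

End Counting.

(** * Truncation ideals *)

Section Upsilon.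
Local Open Scope ring_scope.
Variable F : fieldType.

Lemma exists_superset_card (T : finType) (B : {set T}) k :
  (#|B| <= k <= #|T|)%N -> exists2 A : {set T}, B \subset A & #|A| = k.
Proof.
elim: k => [|k IH] /andP[Bk kT].
  by exists B => //; apply/eqP; rewrite -leqn0.
move: Bk; rewrite leq_eqVlt => /orP[/eqP e|Bk]; first by exists B.
have [|A BA cA] := IH; first by rewrite -ltnS Bk ltnW.
have /subsetPn[x _ xA] : ~~ ([set: T] \subset A).
  by apply: contraL kT => /subset_leq_card; rewrite cardsT cA -leqNgt.
exists (x |: A); last by rewrite cardsU1 xA cA.
by apply: fintype.subset_trans BA _; exact: subsetU1.
Qed.

(** A set of fewer than k letters extends to a set A of k - 1 letters, and the
    restriction factors through the truncation to A. *)
Lemma Upsilon_restr0 k n c (f : 'I_c -> 'I_n) (theta : ass F n) :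
  (c < k)%N -> injective f -> theta \in Upsilon F k n -> restr F f theta = 0.
Proof.
case: k => // k; rewrite ltnS => ck fi /=; case: ifP => [kn th|_]; last first.
  by rewrite memv0 => /eqP ->; rewrite linear0.
have [|A fA /eqP cA] := @exists_superset_card _ (f @: [set: 'I_c]) k.
  by rewrite card_imset// cardsT !card_ord ck ltnW.
have [|r ri ->] := @restr_factor_trunc F _ A _ f fi.
  by move=> i; apply: (fintype.subsetP fA); exact: imset_f.
have -> : trunc F A theta = 0; last by rewrite linear0.
apply/eqP; rewrite -memv_ker; move: th; apply/subvP.
by apply: (bigcapv_inf A) => //; apply/eqP.
Qed.

(** Take m minimal such that some restriction of theta to m letters is not
    in I. *)
Lemma Upsilon_witness k n (theta : ass F n) (I : forall n, {vspace ass F n}) :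
  theta \in Upsilon F k n -> theta \notin I n ->
  exists m (th : ass F m), [/\ (k <= m)%N, th \notin I m &
    forall c (r : 'I_c -> 'I_m), injective r -> (c < m)%N -> restr F r th \in I c].
Proof.
move=> thU thI.
pose P m := `[< exists2 f : 'I_m -> 'I_n, injective f & restr F f theta \notin I m >].
have exP : exists m, P m.
  by exists n; apply/asboolP; exists id => //; rewrite restr_id.
case: (ex_minnP exP) => m /asboolP[f fi fI] mmin.
exists m, (restr F f theta); split=> //.
  by rewrite leqNgt; apply: contra fI => mk; rewrite (Upsilon_restr0 mk fi thU) mem0v.
move=> c r ri cm; rewrite restr_comp//; apply: contraLR cm => H; rewrite -leqNgt.
by apply: mmin; apply/asboolP; exists (f \o r) => //; exact: inj_comp.
Qed.

End Upsilon.

(** * Dimension of the truncation ideals *)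

Section Dimension.
Local Open Scope ring_scope.
Variable F : fieldType.

Lemma dim_cap_lker (V : vectType F) (T : finType) (Y : T -> vectType F)
    (f : forall i, 'Hom(V, Y i)) (P : pred T) (U : {vspace V}) :
  (\dim U <= \dim (U :&: \bigcap_(i | P i) lker (f i))
     + \sum_(i | P i) \dim {: Y i})%N.
Proof.
elim: (index_enum T) U => [|i s IH] U; first by rewrite !big_nil capvf addn0.
rewrite !big_cons; case: ifP => _; last exact: IH.
rewrite capvA addnCA (leq_trans _ (leq_add (leqnn _) (IH _)))//.
by rewrite -(limg_ker_dim (f i) U) addnC leq_add2r dimvS// subvf.
Qed.

Lemma ass_basis_neq0 n (s : 'S_n) : ass_basis F s != 0.
Proof.
apply/eqP => /ffunP/(_ s); rewrite !ffunE eqxx; exact/eqP/oner_neq0.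
Qed.

Lemma dim_ass_card n (A : {set 'I_n}) :
  \dim {: ass F (\sum_(i < n) (i \in A))} = (#|A|)`!.
Proof. by rewrite dim_ass -big_mkcond /= sum1_card. Qed.

Lemma sum_dim_trunc n k :
  (\sum_(A : {set 'I_n} | #|A| == k) \dim {: ass F (\sum_(i < n) (i \in A))}
    = n ^_ k)%N.
Proof.
under eq_bigr => A /eqP cA do rewrite dim_ass_card cA.
by rewrite sum_nat_const -bin_ffact -[in RHS](card_ord n) -card_draws cardsE.
Qed.

(** Upsilon is the common kernel of 'C(n, k) maps to spaces of dimension k!. *)
Lemma codim_Upsilon k n : (k < n)%N -> (n`! <= \dim (Upsilon F k.+1 n) + n ^_ k)%N.
Proof.
move=> kn; rewrite /Upsilon kn -(dim_ass F) -sum_dim_trunc.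
rewrite -[X in (_ <= \dim X + _)%N]capfv.
exact: (dim_cap_lker (fun A : {set 'I_n} => trunc F A) (fun A => #|A| == k) fullv).
Qed.

Lemma dim_ass_quot (I : forall n, {vspace ass F n}) n :
  \dim {: ass_quot I n} = (n`! - \dim (I n))%N.
Proof. by rewrite dim_quotv dim_ass. Qed.

(** The constant k.+1! accounts for the arities n <= k, in which Upsilon is 0. *)
Lemma ass_quot_upper k (I : forall n, {vspace ass F n}) n :
  (Upsilon F k.+1 n <= I n)%VS ->
  (\dim {: ass_quot I n} <= k.+1`! * n.+1 ^ k)%N.
Proof.
move=> /dimvS UI; rewrite dim_ass_quot; have [kn|nk] := ltnP k n.
  rewrite leq_subLR (leq_trans (codim_Upsilon kn))// leq_add//.
  apply: (@leq_trans (n.+1 ^ k)); last by rewrite leq_pmull// fact_gt0.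
  rewrite ffact_prod -[k in leqRHS]card_ord -prod_nat_const.
  by apply: leq_prod => i _; rewrite leqW// leq_subr.
apply: (leq_trans (leq_subr _ _)); apply: (@leq_trans k.+1`!).
  by rewrite leq_fact// leqW.
by rewrite leq_pmulr// expn_gt0.
Qed.

Lemma restr0_factor n (A : {set 'I_n}) (f : 'I_0 -> 'I_n) :
  (lker (trunc F A) <= lker (restr F f))%VS.
Proof.
have [[]//|[]//|r _ rE] := @restr_factor_trunc F _ A _ f.
by apply/subvP => th; rewrite !memv_ker rE => /eqP ->; rewrite linear0.
Qed.

(** There are k + 1 truncations to k letters, with targets of total dimension
    (k + 1) * k! = (k + 1)!, exactly the dimension of the source. Any two of them
    satisfy a relation, since both determine the sum of the coefficients (the
    truncation to no letter); this leaves a common kernel of positive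
    dimension. The bound k > 0 provides two truncations. *)
Lemma Upsilon_top_neq0 k : (0 < k)%N -> Upsilon F k.+1 k.+1 != 0%VS.
Proof.
move=> k_gt0; rewrite -dimv_eq0 -lt0n -(ltn_add2r (k.+1 ^_ k)) add0n.
have fullE : (k.+1 ^_ k = k.+1`!)%N by rewrite -ffactnn ffactnSr subSnn muln1.
rewrite {1}fullE -(dim_ass F k.+1) -sum_dim_trunc /Upsilon leqnn.
pose A : {set 'I_k.+1} := [set~ ord0]; pose B : {set 'I_k.+1} := [set~ ord_max].
have cA : #|A| = k by rewrite cardsC1 card_ord.
have cB : #|B| = k by rewrite cardsC1 card_ord.
have BA : B != A.
  apply/eqP => /setP/(_ ord0); rewrite !inE eqxx -val_eqE /= eq_sym.
  by rewrite -lt0n k_gt0.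
rewrite (bigD1 A) ?cA//= (bigD1 B) ?cB ?BA// ?eqxx//= capvA.
rewrite [X in (_ < _ + X)%N](bigD1 A) ?cA//=.
rewrite [X in (_ < _ + (_ + X))%N](bigD1 B) ?cB ?BA ?eqxx//=.
(* The hyperplane of elements whose coefficients sum to zero. *)
pose K := lker (restr F (fun i : 'I_0 => widen_ord (leq0n k.+1) i)).
have K_lt : (\dim K < \dim {: ass F k.+1})%N.
  have := dimvS (subvf K); rewrite leq_eqVlt => /orP[|//].
  rewrite (dimv_leqif_eq (subvf K)) => /eqP KE.
  have : ass_basis F (1%g : 'S_k.+1) \in K by rewrite KE memvf.
  by rewrite memv_ker ass_map_basis (negbTE (ass_basis_neq0 _)).
have KAB : (\dim (lker (trunc F A) + lker (trunc F B)) <= \dim K)%N.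
  by apply: dimvS; rewrite subv_add !restr0_factor.
have kerd C : (\dim {: ass F k.+1} <= \dim (lker (trunc F C)) +
    \dim {: ass F (\sum_(i < k.+1) (i \in C))})%N.
  rewrite -(limg_ker_dim (trunc F C) fullv) capfv leq_add2l.
  exact/dimvS/subvf.
have := dim_cap_lker (fun C => trunc F C)
  (fun C : {set 'I_k.+1} => (#|C| == k) && (C != A) && (C != B))
  (lker (trunc F A) :&: lker (trunc F B)).
have := dimv_sum_cap (lker (trunc F A)) (lker (trunc F B)).
move: (kerd A) (kerd B) KAB K_lt => /=.
have arith (N a b dA dB s t c x S : nat) : (N <= a + dA -> N <= b + dB -> s <= t ->
  t < N -> s + c = a + b -> c <= x + S -> N < x + (dA + (dB + S)))%N by lia.
exact: arith.
Qed.

(** There is one word in at most one letter, so the truncations to no letter and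
    to one letter both amount to the sum of the coefficients. In arity 1 this sum
    is injective. *)
Lemma Upsilon1_sub2 n : (Upsilon F 1 n <= Upsilon F 2 n)%VS.
Proof.
have tot m (phi : 'S_n -> 'S_m) theta t : (m <= 1)%N ->
    ass_map F phi theta t = \sum_s theta s.
  move=> m1; rewrite ass_mapE sum_ffunE; apply: eq_bigr => s _.
  rewrite !ffunE (_ : t == phi s) ?[_ *: _]mulr1//.
  apply/eqP/permP => i; apply/val_inj => /=; have := leq_trans (ltn_ord (t i)) m1.
  by have := leq_trans (ltn_ord (phi s i)) m1; rewrite !ltnS !leqn0 => /eqP-> /eqP->.
have U1 theta : (0 < n)%N -> theta \in Upsilon F 1 n -> \sum_s theta s = 0.
  move=> n0 th; pose f := widen_ord (leq0n n).
  have := @Upsilon_restr0 F 1 n 0 f _ isT _ th.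
  move=> /(_ _)/ffunP/(_ 1%g); rewrite tot//= ffunE; apply.
  by case.
apply/subvP => theta th; have [n1|] := leqP 2 n.
  have th0 := U1 _ (ltnW n1) th.
  rewrite memvE /Upsilon n1; apply/subv_bigcapP => A /eqP cA; rewrite -memvE.
  rewrite memv_ker trunc_restr; apply/eqP/ffunP => t; rewrite tot ?th0 ?ffunE//.
  by rewrite -big_mkcond/= sum1_card cA.
case: n => [|[|//]] in theta tot U1 th *; first by [].
move=> _; rewrite /Upsilon /= memv0; apply/eqP/ffunP => t.
have := U1 _ isT th; rewrite (bigD1 t)//= big1 ?addr0; first by move=> ->; rewrite ffunE.
move=> s /eqP[]; apply/permP => i; apply/val_inj; case: (s i) (t i) => [[]// ?] [[]// ?].
Qed.

End Dimension.

(** * From polynomial bounds to the GK-dimension *)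

Section Growth.
Local Open Scope classical_set_scope.
Variable R : realType.

Lemma le_limn_esup (u v : (\bar R)^nat) :
  (\forall n \near \oo, u n <= v n) -> limn_esup u <= limn_esup v.
Proof.
move=> uv; rewrite /limn_esup !limf_esupE; apply: le_ereal_inf_tmp => _ [A Aoo <-].
apply: (@le_trans _ _ (ereal_sup (u @` (A `&` [set n | u n <= v n])))).
  by apply: ereal_inf_lbound; exists (A `&` [set n | u n <= v n]) => //; exact: filterI.
apply: ge_ereal_sup => _ [n [An uvn] <-]; apply: (le_trans uvn).
by apply: ereal_sup_ubound; exists n.
Qed.

(** The expression is d + ln c / ln n. *)
Lemma cvg_log_pow (c : R) d : (0 < c)%R ->
  (ln (c * n%:R ^+ d) * (ln n%:R)^-1)%:E @[n --> \oo] --> (d%:R : R)%:E.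
Proof.
move=> c0.
have ln_oo : (ln n%:R : R) @[n --> \oo] --> +oo%R.
  apply/cvgryPge => M; near=> n.
  have Mn : (expR M <= n%:R)%R by near: n; exact: nbhs_infty_ger.
  by rewrite -(expRK M) ler_ln// posrE ?expR_gt0// (lt_le_trans _ Mn)// expR_gt0.
have lnV0 : ((ln n%:R)^-1 : R)%R @[n --> \oo] --> (0 : R)%R.
  by apply/gtr0_cvgV0 => //; move/cvgryPgt : ln_oo; exact.
have : (d%:R + ln c * (ln n%:R)^-1 : R)%R @[n --> \oo] --> (d%:R + ln c * 0 : R)%R.
  by apply: cvgD; [exact: cvg_cst|apply: cvgM => //; exact: cvg_cst].
rewrite mulr0 addr0 => lim; apply: cvg_EFin.
  by near=> n.
apply: cvg_trans lim; apply: near_eq_cvg; near=> n => /=.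
have n1 : (1 < n)%N by near: n; exact: nbhs_infty_gt.
have n0 : (0 < n%:R :> R)%R by rewrite ltr0n ltnW.
have ln0 : ln (n%:R : R) != 0%R by rewrite gt_eqF// ln_gt0// ltr1n.
by rewrite lnM ?posrE ?exprn_gt0// lnXn// mulrDl -(mulr_natl (ln n%:R)) mulfK// addrC.
Unshelve. all: by end_near. Qed.

Lemma lne_mono (x y z : R) : (0 < y)%R -> (x <= y)%R -> (0 <= z)%R ->
  lne x%:E * z%:E <= lne y%:E * z%:E.
Proof.
move=> y0 xy z0; apply: lee_wpmul2r; first by rewrite lee_fin.
rewrite /lne; case: ifPn => [_|]; first by rewrite leNye.
rewrite -ltNge => x0; rewrite ifF; last exact/lt_geF.
by rewrite lee_fin ler_ln ?posrE.
Qed.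

Lemma ln_inv_ge0 n : (0 <= (ln (n%:R : R))^-1)%R.
Proof.
rewrite invr_ge0; case: n => [|n]; first by rewrite ln0.
by rewrite ln_ge0 ?ler1n.
Qed.

Lemma GKdim_le (F : fieldType) (P : nat -> vectType F) (c : R) d : (0 < c)%R ->
  (\forall n \near \oo, (\sum_(i < n.+1) \dim {: P i})%N%:R <= c * n%:R ^+ d)%R ->
  GKdim R P <= d%:R%:E.
Proof.
move=> c0 Pc; have [_ <-] := cvg_limn_einf_sup (@cvg_log_pow c d c0).
apply: le_limn_esup; near=> n.
have cn : (0 < c * n%:R ^+ d)%R.
  by rewrite mulr_gt0// exprn_gt0// ltr0n; near: n; exact: nbhs_infty_gt.
rewrite EFinM -(lne_EFin cn); apply: lne_mono; [exact: cn| |exact: ln_inv_ge0].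
by near: n.
Unshelve. all: by end_near. Qed.

Lemma GKdim_ge (F : fieldType) (P : nat -> vectType F) (c : R) d : (0 < c)%R ->
  (\forall n \near \oo, c * n%:R ^+ d <= (\sum_(i < n.+1) \dim {: P i})%N%:R)%R ->
  d%:R%:E <= GKdim R P.
Proof.
move=> c0 Pc; have [_ <-] := cvg_limn_einf_sup (@cvg_log_pow c d c0).
apply: le_limn_esup; near=> n.
have cn : (0 < c * n%:R ^+ d)%R.
  by rewrite mulr_gt0// exprn_gt0// ltr0n; near: n; exact: nbhs_infty_gt.
have cP : (c * n%:R ^+ d <= (\sum_(i < n.+1) \dim {: P i})%N%:R)%R by near: n.
rewrite EFinM -(lne_EFin cn); apply: lne_mono; [|exact: cP|exact: ln_inv_ge0].
exact: lt_le_trans cP.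
Unshelve. all: by end_near. Qed.

(** Every factor n + 1 - i, i <= m, of the falling factorial is at least n / 2. *)
Lemma pow_le_bin m n : (m <= n./2)%N ->
  (n ^ m.+1 <= 2 ^ m.+1 * m.+1`! * 'C(n.+1, m.+1))%N.
Proof.
move=> mn; rewrite -mulnA [(_`! * _)%N]mulnC bin_ffact ffact_prod.
rewrite -[X in (2 ^ X)%N](card_ord m.+1) -[X in (n ^ X)%N](card_ord m.+1).
rewrite -!prod_nat_const -big_split /=; apply: leq_prod => i _.
have := ltn_ord i; lia.
Qed.

Lemma sum_bin m n : (\sum_(i < n) 'C(i, m) = 'C(n, m.+1))%N.
Proof.
by elim: n => [|n IH]; [rewrite big_ord0|rewrite big_ord_recr /= IH binS].
Qed.

(** The sum of 'C(i, m) over i <= n is 'C(n + 1, m + 1), of order n^(m + 1). *)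
Lemma GKdim_ge_bin (F : fieldType) (P : nat -> vectType F) m :
  (forall n, 'C(n, m) <= \dim {: P n})%N -> m.+1%:R%:E <= GKdim R P.
Proof.
move=> Pm; pose C := (2 ^ m.+1 * m.+1`!)%N.
have C0 : (0 < C%:R :> R)%R by rewrite ltr0n muln_gt0 expn_gt0 fact_gt0.
apply: (@GKdim_ge _ _ C%:R^-1); first by rewrite invr_gt0.
near=> n; rewrite mulrC ler_pdivrMr// -natrX -natrM ler_nat.
have mn : (m.*2 <= n)%N by near: n; exact: nbhs_infty_ge.
apply: (@leq_trans (C * 'C(n.+1, m.+1))); first by apply: pow_le_bin; lia.
by rewrite mulnC leq_mul2r -sum_bin leq_sum ?orbT.
Unshelve. all: by end_near. Qed.

End Growth.

(** * GK-dimension of quotients of Ass *)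

Section Main.
Variables (R : realType) (F : fieldType).

Lemma GKdim_ass_quot_le k (I : forall n, {vspace ass F n}) :
  (forall n, Upsilon F k.+1 n <= I n)%VS -> GKdim R (ass_quot I) <= k.+1%:R%:E.
Proof.
move=> UI; pose C := (k.+1`! * 2 ^ k.+1)%N.
have C0 : (0 < C%:R :> R)%R by rewrite ltr0n muln_gt0 expn_gt0 fact_gt0.
apply: (GKdim_le C0); near=> n; rewrite -natrX -natrM ler_nat.
have n0 : (0 < n)%N by near: n; exact: nbhs_infty_gt.
apply: (@leq_trans (\sum_(i < n.+1) k.+1`! * n.+1 ^ k)).
  apply: leq_sum => i _; apply: leq_trans (ass_quot_upper (UI i)) _.
  by apply: leq_mul => //; case: (k) => // e; rewrite leq_exp2r.
rewrite sum_nat_const card_ord mulnCA -expnS /C -mulnA leq_mul2l -expnMn.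
by rewrite leq_exp2r ?orbT//; lia.
Unshelve. all: by end_near. Qed.

Lemma GKdim_ideal_ge (I : forall n, {vspace ass F n}) k n :
  operadic_ideal I -> ~~ (Upsilon F k n <= I n)%VS ->
  k.+1%:R%:E <= GKdim R (ass_quot I).
Proof.
move=> idI /subvPn[th thU thI].
have [m [y [km yI yr]]] := Upsilon_witness thU thI.
apply: (@le_trans _ _ m.+1%:R%:E); first by rewrite lee_fin ler_nat.
apply: GKdim_ge_bin => l; rewrite dim_ass_quot leq_subRL; last first.
  by rewrite -(dim_ass F) dimvS// subvf.
apply: (dim_lower (J := I) (theta := y)) => //.
- by move=> c p g z gi zI; exact: ideal_pad.
- by move=> f fi w wI; exact: ideal_restr.
Qed.

(** Here the family J of [dim_lower] is zero: restrictions of elements of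
    Upsilon^k to m < k letters vanish. *)
Lemma GKdim_Upsilon_ge k m (theta : ass F m) : (m < k)%N -> theta != 0%R ->
  (forall c (r : 'I_c -> 'I_m), injective r -> (c < m)%N -> restr F r theta = 0%R) ->
  m.+1%:R%:E <= GKdim R (ass_quot (Upsilon F k)).
Proof.
move=> mk th0 thr; apply: GKdim_ge_bin => l; rewrite dim_ass_quot leq_subRL; last first.
  by rewrite -(dim_ass F) dimvS// subvf.
apply: (dim_lower (J := fun=> 0%VS) (theta := theta)).
- by move=> c p g z gi; rewrite !memv0 => /eqP ->; rewrite linear0.
- by move=> c r ri cm; rewrite thr// mem0v.
- by rewrite memv0.
- by move=> f fi w wU; rewrite (Upsilon_restr0 mk fi wU) mem0v.
Qed.

End Main.

Theorem corollary0p2 (R : realType) (F : fieldType) (k : nat) (k_gt0 : (0 < k)%N) :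
  (forall I : forall n, {vspace ass F n},
     operadic_ideal I ->
     GKdim R (ass_quot I) <= k%:R%:E <->
     forall n, (Upsilon F k n <= I n)%VS) /\
  GKdim R (ass_quot (Upsilon F k)) = if (k <= 2)%N then 1 else k%:R%:E.
Proof.
split=> [I idI|].
  split=> [gk n|]; last by case: k k_gt0 => // k _; exact: GKdim_ass_quot_le.
  apply/negPn/negP => nU.
  have := le_trans (GKdim_ideal_ge R idI nU) gk.
  by rewrite lee_fin ler_nat ltnn.
apply/eqP; rewrite eq_le; apply/andP; split.
  case: k k_gt0 => [|[|[|k]]] // _.
  - exact: (@GKdim_ass_quot_le _ _ 0).
  - by apply: (@GKdim_ass_quot_le _ _ 0); exact: Upsilon1_sub2.
  - exact: GKdim_ass_quot_le.
case: ifPn => [k2|]; last first.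
  rewrite -ltnNge; case: k k_gt0 => [|[|k]] // _ k1.
  have := vpick0 (Upsilon F k.+1 k.+1); rewrite (negbTE (Upsilon_top_neq0 _ _))//.
  move=> /negbT th0; apply: (@GKdim_Upsilon_ge _ _ _ k.+1 (vpick (Upsilon F k.+1 k.+1))) => //.
  by move=> c r ri ck; apply: (Upsilon_restr0 ck ri); exact: memv_pick.
apply: (@GKdim_Upsilon_ge _ _ _ 0 (ass_basis F 1%g)) => //; exact: ass_basis_neq0.
Qed.
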